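(* Let $p$ be a prime and let $\alpha \in \mathbb{Q}_p$ be quadratic over $\mathbb{Q}$ (i.e. algebraic over $\mathbb{Q}$ of degree exactly two). Then for each of Algorithms A, B and C, the continued fraction expansion of $\alpha$ obtained by that algorithm is eventually periodic.
   Context: Let $p$ be a prime, $v_p$ the $p$-adic additive valuation and $|\alpha|_p = p^{-v_p(\alpha)}$. Each $\alpha\in\mathbb{Q}_p$ has a unique $p$-adic expansion $\alpha=\sum_{i} e_i p^i$ with $e_i\in\{0,1,\dots,p-1\}$ and $e_i\ne 0$ for at most finitely many $i\le 0$; put $[\alpha]=\sum_{i\le 0} e_i p^i$ and $\langle\alpha\rangle=\sum_{i\ge 1}e_ip^i$, so $\alpha=[\alpha]+\langle\alpha\rangle$. Let $A_p$ be the set of elements of $p\mathbb{Z}_p$ that are algebraic over $\mathbb{Q}$ of degree at most two. The minimal polynomial of an algebraic element is its integral polynomial of lowest degree with positive leading coefficient and coprime coefficients. For $x\in A_p$ write it as $aX^2+bX+c$ if $x$ is quadratic and as $bX+c$ if $x$ is rational. For $x\in A_p\setminus\{0\}$ put $u(x)=c|c|_p\in\mathbb{Z}\setminus p\mathbb{Z}$, and define maps $T_1,T_2:A_p\setminus\{0\}\to A_p$ by $$T_1(x)=\frac{u(x)p^{v_p(x)}}{x}-d_1(x),\qquad T_2(x)=\frac{-u(x)p^{v_p(x)}}{x}-d_2(x),$$ where $d_1(x),d_2(x)\in\{1,\dots,p-1\}$ are the unique choices making $T_1(x),T_2(x)\in p\mathbb{Z}_p$. The three algorithms are given by the following maps $T:A_p\setminus\{0\}\to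 A_p$ (where the minimal polynomial of $x$ is $aX^2+bX+c$ if $x$ is quadratic and $bX+c$ if $x$ is rational). Algorithm A: $T(x)=T_2(x)$. Algorithm B: $T(x)=T_2(x)$ if $b\ge 0$, and $T(x)=T_1(x)$ if $b<0$. Algorithm C: $T(x)=T_2(x)$ if $b\ge 0$ and $c>0$, and $T(x)=T_1(x)$ otherwise. For a given algorithm put $t(x)=u(x)$, $d(x)=d_1(x)$ when $T(x)$ is defined as $T_1(x)$, and $t(x)=-u(x)$, $d(x)=d_2(x)$ when $T(x)$ is defined as $T_2(x)$; thus $T(x)=t(x)p^{v_p(x)}/x-d(x)$. The expansion of $\alpha\in\mathbb{Q}_p$ (algebraic of degree at most two) by the algorithm is the continued fraction $$[\alpha]+\cfrac{t_1p^{k_1}}{d_1+\cfrac{t_2p^{k_2}}{d_2+\cfrac{t_3p^{k_3}}{\ddots}}},\qquad t_i=t(T^{i-1}(\langle\alpha\rangle)),\ k_i=v_p(T^{i-1}(\langle\alpha\rangle)),\ d_i=d(T^{i-1}(\langle\alpha\rangle)),$$ which terminates after the $N$-th term if $T^N(\langle\alpha\rangle)=0$ for some (first) $N\ge 0$ (for $N=0$ it is just $[\alpha]$), and is infinite otherwise. The expansion is eventually periodic if it is infinite and there are $\ell\ge1$ and $M\ge1$ with $(t_{i+\ell},k_{i+\ell},d_{i+\ell})=(t_i,k_i,d_i)$ for all $i\ge M$. *)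

(* Defs.v *)
From HB Require Import structures.
From mathcomp Require Import all_boot all_order all_algebra.
From mathcomp Require Import boolp classical_sets cardinality fsbigop.

Set Implicit Arguments.
Unset Strict Implicit.
Unset Printing Implicit Defensive.

Import Order.TTheory GRing.Theory Num.Theory.
Local Open Scope classical_set_scope.
Local Open Scope ring_scope.

(* Z_p is the inverse limit of the rings Z/p^n: a p-adic integer is the
   coherent sequence of its residues in {0, ..., p^n - 1}.  The primality proof
   is an argument of the type because the ring instances depend on it. *)
Record padic_int (p : nat) (p_pr : prime p) := PadicInt {
  padic_res :> nat -> int;
  _ : forall m n, (m <= n)%N -> padic_res m = (padic_res n %% (p ^ m)%N)%Z
}.

Lemma padic_resP p (p_pr : prime p) (x : padic_int p_pr) m n :
  (m <= n)%N -> x m = (x n %% (p ^ m)%N)%Z.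
Proof. by case: x => f /= h; apply: h. Qed.

Lemma padic_intP p (p_pr : prime p) (x y : padic_int p_pr) :
  (forall n, x n = y n) -> x = y.
Proof.
case: x y => f hf [g hg] /= fg; have {}fg : f = g by apply/funext.
by subst g; congr PadicInt; apply: Prop_irrelevance.
Qed.

Lemma padic_of_subproof p (f : nat -> int) :
  (forall m n, (m <= n)%N -> (f m = f n %[mod (p ^ m)%N])%Z) ->
  forall m n, (m <= n)%N ->
    (f m %% (p ^ m)%N)%Z = ((f n %% (p ^ n)%N)%Z %% (p ^ m)%N)%Z.
Proof.
move=> hf m n le_mn; rewrite (hf _ _ le_mn); apply/eqP.
rewrite eqz_mod_dvd (@dvdz_trans (p ^ n)%N) //.
  by rewrite dvdzE /= dvdn_exp2l.
by rewrite -eqz_mod_dvd modz_mod.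
Qed.

Definition padic_of p (p_pr : prime p) (f : nat -> int)
    (hf : forall m n, (m <= n)%N -> (f m = f n %[mod (p ^ m)%N])%Z) :
    padic_int p_pr :=
  PadicInt p_pr (padic_of_subproof hf).

Lemma padic_res_mod p (p_pr : prime p) (x : padic_int p_pr) m n :
  (m <= n)%N -> (x m = x n %[mod (p ^ m)%N])%Z.
Proof. by move=> le_mn; rewrite (padic_resP x le_mn) modz_mod. Qed.

Lemma padic_res_id p (p_pr : prime p) (x : padic_int p_pr) n :
  (x n %% (p ^ n)%N)%Z = x n.
Proof. by rewrite -padic_resP. Qed.

Lemma padic_cst_subproof p (c : int) m n :
  (m <= n)%N -> (c = c %[mod (p ^ m)%N])%Z.
Proof. by []. Qed.

Lemma padic_add_subproof p (p_pr : prime p) (x y : padic_int p_pr) m n :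
  (m <= n)%N -> (x m + y m = x n + y n %[mod (p ^ m)%N])%Z.
Proof.
by move=> le; rewrite -modzDm (padic_res_mod x le) (padic_res_mod y le) modzDm.
Qed.

Lemma padic_opp_subproof p (p_pr : prime p) (x : padic_int p_pr) m n :
  (m <= n)%N -> (- x m = - x n %[mod (p ^ m)%N])%Z.
Proof. by move=> le; rewrite -modzNm (padic_res_mod x le) modzNm. Qed.

Lemma padic_mul_subproof p (p_pr : prime p) (x y : padic_int p_pr) m n :
  (m <= n)%N -> (x m * y m = x n * y n %[mod (p ^ m)%N])%Z.
Proof.
by move=> le; rewrite -modzMm (padic_res_mod x le) (padic_res_mod y le) modzMm.
Qed.

Definition padic_cst p (p_pr : prime p) (c : int) : padic_int p_pr :=
  padic_of p_pr (@padic_cst_subproof p c).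
Definition padic_add p (p_pr : prime p) (x y : padic_int p_pr) :=
  padic_of p_pr (padic_add_subproof x y).
Definition padic_opp p (p_pr : prime p) (x : padic_int p_pr) :=
  padic_of p_pr (padic_opp_subproof x).
Definition padic_mul p (p_pr : prime p) (x y : padic_int p_pr) :=
  padic_of p_pr (padic_mul_subproof x y).

HB.instance Definition _ p (p_pr : prime p) := gen_eqMixin (padic_int p_pr).
HB.instance Definition _ p (p_pr : prime p) := gen_choiceMixin (padic_int p_pr).

Lemma padic_addA p (p_pr : prime p) : associative (@padic_add p p_pr).
Proof.
by move=> x y z; apply: padic_intP => n /=; rewrite modzDml modzDmr addrA.
Qed.

Lemma padic_addC p (p_pr : prime p) : commutative (@padic_add p p_pr).
Proof. by move=> x y; apply: padic_intP => n /=; rewrite addrC. Qed.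

Lemma padic_add0 p (p_pr : prime p) :
  left_id (padic_cst p_pr 0) (@padic_add p p_pr).
Proof.
by move=> x; apply: padic_intP => n /=; rewrite modzDml add0r padic_res_id.
Qed.

Lemma padic_addN p (p_pr : prime p) :
  left_inverse (padic_cst p_pr 0) (@padic_opp p p_pr) (@padic_add p p_pr).
Proof. by move=> x; apply: padic_intP => n /=; rewrite modzDml addNr. Qed.

HB.instance Definition _ p (p_pr : prime p) :=
  GRing.isZmodule.Build (padic_int p_pr)
    (@padic_addA p p_pr) (@padic_addC p p_pr) (@padic_add0 p p_pr)
    (@padic_addN p p_pr).

Lemma padic_mulA p (p_pr : prime p) : associative (@padic_mul p p_pr).
Proof.
by move=> x y z; apply: padic_intP => n /=; rewrite modzMml modzMmr mulrA.
Qed.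

Lemma padic_mulC p (p_pr : prime p) : commutative (@padic_mul p p_pr).
Proof. by move=> x y; apply: padic_intP => n /=; rewrite mulrC. Qed.

Lemma padic_mul1 p (p_pr : prime p) :
  left_id (padic_cst p_pr 1) (@padic_mul p p_pr).
Proof.
by move=> x; apply: padic_intP => n /=; rewrite modzMml mul1r padic_res_id.
Qed.

Lemma padic_mulD p (p_pr : prime p) :
  left_distributive (@padic_mul p p_pr) (@padic_add p p_pr).
Proof.
by move=> x y z; apply: padic_intP => n /=; rewrite modzMml mulrDl modzDm.
Qed.

Lemma padic_one_neq0 p (p_pr : prime p) :
  padic_cst p_pr 1 != 0 :> padic_int p_pr.
Proof.
apply/eqP => /(congr1 (fun x : padic_int p_pr => x 1%N)) /=.
by rewrite expn1 mod0z modz_small //= ltz_nat prime_gt1.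
Qed.

HB.instance Definition _ p (p_pr : prime p) :=
  GRing.Zmodule_isComNzRing.Build (padic_int p_pr)
    (@padic_mulA p p_pr) (@padic_mulC p p_pr) (@padic_mul1 p p_pr)
    (@padic_mulD p p_pr) (@padic_one_neq0 p p_pr).

Definition padic_unit p (p_pr : prime p) : {pred padic_int p_pr} :=
  fun x => `[< exists y, y * x = 1 >].

Definition padic_inv p (p_pr : prime p) (x : padic_int p_pr) : padic_int p_pr :=
  xget x [set y | y * x = 1].

Lemma padic_mulVx p (p_pr : prime p) :
  {in @padic_unit p p_pr, left_inverse 1 (@padic_inv p p_pr) *%R}.
Proof. by move=> x /asboolP[y yx]; exact: (@xgetI (padic_int p_pr) x [set y | y * x = 1] y yx). Qed.

Lemma padic_unitPl p (p_pr : prime p) (x y : padic_int p_pr) :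
  y * x = 1 -> padic_unit x.
Proof. by move=> yx; apply/asboolP; exists y. Qed.

Lemma padic_invr_out p (p_pr : prime p) :
  {in [predC @padic_unit p p_pr], @padic_inv p p_pr =1 id}.
Proof.
move=> x /asboolPn nx; apply: xgetPN => y yx; apply: nx.
by exists y.
Qed.

HB.instance Definition _ p (p_pr : prime p) :=
  GRing.ComNzRing_hasMulInverse.Build (padic_int p_pr)
    (@padic_mulVx p p_pr) (@padic_unitPl p p_pr) (@padic_invr_out p p_pr).

Lemma padic_int_neq0 p (p_pr : prime p) (x : padic_int p_pr) :
  x != 0 -> exists n, ~~ ((p ^ n)%N %| x n)%Z.
Proof.
move=> x0; apply: contrapT => h; case/eqP: x0; apply: padic_intP => n /=.
rewrite mod0z -padic_res_id; apply/dvdz_mod0P.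
by apply: contrapT => /negP hn; apply: h; exists n.
Qed.

Lemma padic_dvd_res p (p_pr : prime p) (x : padic_int p_pr) m n :
  (m <= n)%N -> ((p ^ m)%N %| x n)%Z = ((p ^ m)%N %| x m)%Z.
Proof.
move=> le; apply/dvdz_mod0P/dvdz_mod0P; by rewrite (padic_res_mod x le).
Qed.

Lemma padic_integral p (p_pr : prime p) :
  GRing.integral_domain_axiom (padic_int p_pr).
Proof.
move=> x y xy; apply: contrapT => /negP; rewrite negb_or => /andP[].
move=> /padic_int_neq0[m hx] /padic_int_neq0[n hy].
have : ((p ^ (m + n))%N %| x (m + n)%N * y (m + n)%N)%Z.
  move/(congr1 (fun z : padic_int p_pr => z (m + n)%N)): xy => /=.
  by rewrite mod0z => /dvdz_mod0P.
rewrite -(padic_dvd_res x (leq_addr n m)) in hx.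
rewrite -(padic_dvd_res y (leq_addl m n)) in hy.
move: (x _) (y _) hx hy => a b; rewrite !dvdzE abszM /= => ha hb.
have a0 : (0 < `|a|)%N by case: `|a|%N ha => //; rewrite dvdn0.
have b0 : (0 < `|b|)%N by case: `|b|%N hb => //; rewrite dvdn0.
move: ha hb; rewrite !pfactor_dvdn ?muln_gt0 ?a0 // lognM // -!ltnNge.
by move=> ha hb; rewrite leqNgt (leq_trans _ (leq_add ha hb)) // addSn addnS ltnW.
Qed.

HB.instance Definition _ p (p_pr : prime p) :=
  GRing.ComUnitRing_isIntegral.Build (padic_int p_pr) (@padic_integral p p_pr).

Definition padic p (p_pr : prime p) := {fraction padic_int p_pr}.
HB.instance Definition _ p (p_pr : prime p) := GRing.Field.on (padic p_pr).

Definition padic_of_int p (p_pr : prime p) (a : padic_int p_pr) : padic p_pr :=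
  @FracField.tofrac (padic_int p_pr) a.

(* The value at 0 (where v_p is +oo) is the junk value 0. *)
Definition padic_val p (p_pr : prime p) (x : padic p_pr) : int :=
  xget 0 [set k : int | exists2 w : padic_int p_pr,
                          w \is a GRing.unit & x = p%:R ^ k * padic_of_int w].

Definition padic_abs p (p_pr : prime p) (x : padic p_pr) : rat :=
  if x == 0 then 0 else p%:R ^ (- padic_val x).

Definition in_pZp p (p_pr : prime p) (x : padic p_pr) : Prop :=
  exists a : padic_int p_pr, x = p%:R * padic_of_int a.

(* A sum over the indices i in A for which the summand is nonzero; it is 0 by
   convention if there are infinitely many of them. *)
Definition digit_sum p (p_pr : prime p) (e : int -> nat) (A : set int) :
    padic p_pr :=
  \sum_(i \in A) ((e i)%:R * p%:R ^ i : padic p_pr).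

Definition is_padic_expansion p (p_pr : prime p) (e : int -> nat)
    (x : padic p_pr) : Prop :=
  [/\ forall i, (e i < p)%N,
      finite_set [set i : int | (i <= 0) && (e i != 0%N)] &
      forall eps : rat, 0 < eps -> exists N : nat, forall n : nat, (N <= n)%N ->
        padic_abs (x - digit_sum p_pr e [set i : int | i <= n%:Z]) < eps].

Definition padic_digit p (p_pr : prime p) (x : padic p_pr) : int -> nat :=
  xget (fun=> 0%N) [set e | is_padic_expansion e x].

Definition padic_head p (p_pr : prime p) (x : padic p_pr) : padic p_pr :=
  digit_sum p_pr (padic_digit x) [set i : int | i <= 0].

(* This is the sum of the digits of index i >= 1, since the whole series
   converges to x. *)
Definition padic_tail p (p_pr : prime p) (x : padic p_pr) : padic p_pr :=
  x - padic_head x.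

Definition annihilates p (p_pr : prime p) (q : {poly int}) (x : padic p_pr) :=
  (q != 0) && root (map_poly intr q) x.

Definition is_minpoly p (p_pr : prime p) (q : {poly int}) (x : padic p_pr) :
    Prop :=
  [/\ annihilates q x,
      forall r, annihilates r x -> (size q <= size r)%N,
      0 < lead_coef q &
      zcontents q = 1].

(* Equal to 0 when x is transcendental. *)
Definition minpoly p (p_pr : prime p) (x : padic p_pr) : {poly int} :=
  xget 0 [set q | is_minpoly q x].

Definition quadratic p (p_pr : prime p) (x : padic p_pr) : Prop :=
  exists2 q : {poly int}, is_minpoly q x & size q = 3%N.

(* For both a X^2 + b X + c and b X + c, the integers b and c are the
   coefficients of index 1 and 0. *)
Definition coef_b p (p_pr : prime p) (x : padic p_pr) : int := (minpoly x)`_1.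
Definition coef_c p (p_pr : prime p) (x : padic p_pr) : int := (minpoly x)`_0.

(* c |c|_p, which is an integer although it is computed in rat. *)
Definition upart p (p_pr : prime p) (x : padic p_pr) : rat :=
  (coef_c x)%:~R * padic_abs ((coef_c x)%:~R : padic p_pr).

(* The common shape of the maps T_1 (s = u) and T_2 (s = - u).  They
   are meaningful on the nonzero elements of p Z_p of degree at most 2, which
   is where the expansion uses them; their values elsewhere are junk. *)
Definition inv_part p (p_pr : prime p) (s : rat) (x : padic p_pr) :
    padic p_pr :=
  ratr s * p%:R ^ padic_val x / x.

Definition shift_digit p (p_pr : prime p) (s : rat) (x : padic p_pr) : nat :=
  xget 0%N [set d : nat | (0 < d < p)%N /\ in_pZp (inv_part s x - d%:R)].

Definition d1 p (p_pr : prime p) (x : padic p_pr) := shift_digit (upart x) x.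
Definition d2 p (p_pr : prime p) (x : padic p_pr) := shift_digit (- upart x) x.

Definition T1 p (p_pr : prime p) (x : padic p_pr) : padic p_pr :=
  inv_part (upart x) x - (d1 x)%:R.
Definition T2 p (p_pr : prime p) (x : padic p_pr) : padic p_pr :=
  inv_part (- upart x) x - (d2 x)%:R.

Inductive algorithm := AlgorithmA | AlgorithmB | AlgorithmC.

Definition chooses_T2 (alg : algorithm) p (p_pr : prime p) (x : padic p_pr) :
    bool :=
  match alg with
  | AlgorithmA => true
  | AlgorithmB => 0 <= coef_b x
  | AlgorithmC => (0 <= coef_b x) && (0 < coef_c x)
  end.

Definition alg_T alg p (p_pr : prime p) (x : padic p_pr) : padic p_pr :=
  if chooses_T2 alg x then T2 x else T1 x.
Definition alg_t alg p (p_pr : prime p) (x : padic p_pr) : rat :=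
  if chooses_T2 alg x then - upart x else upart x.
Definition alg_d alg p (p_pr : prime p) (x : padic p_pr) : nat :=
  if chooses_T2 alg x then d2 x else d1 x.

(* A continued fraction cf_int + t_1 p^k_1 / (d_1 + t_2 p^k_2 / (d_2 + ...)):
   cf_term i is (t_i, k_i, d_i) for i >= 1, or None if the fraction has
   terminated before its i-th term; the value at i = 0 is irrelevant. *)
Record pcfrac (p : nat) (p_pr : prime p) := PCFrac {
  cf_int : padic p_pr;
  cf_term : nat -> option (rat * int * nat)
}.

Definition expansion alg p (p_pr : prime p) (x : padic p_pr) : pcfrac p_pr :=
  let orbit i := iter i (alg_T alg (p_pr := p_pr)) (padic_tail x) in
  PCFrac (padic_head x)
    (fun i => if [exists j : 'I_i, orbit j == 0] then None
              else let y := orbit i.-1 in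
                   Some (alg_t alg y, padic_val y, alg_d alg y)).

Definition eventually_periodic p (p_pr : prime p) (f : pcfrac p_pr) : Prop :=
  (forall i, (1 <= i)%N -> cf_term f i != None) /\
  exists l M, [/\ (1 <= l)%N, (1 <= M)%N &
    forall i, (M <= i)%N -> cf_term f (i + l) = cf_term f i].

(* Main.v *)
(* Let x in pZ_p be irrational with conjugate x'.  A step of any of the
   algorithms is y = s p^k / x - d with p not dividing s and k = v_p(x), so the
   conjugate of y is y' = s p^k / x' - d and
   v_p(y - y') = v_p(x - x') - v_p(x').  Hence the conjugate cannot stay in
   pZ_p for ever.  Once x' is outside pZ_p, the coefficient b of a X^2 + b X + c
   is prime to p and c = u p^k; then y = e a x' - d and y' = e a x - d with
   e = 1 for T_1 and e = -1 for T_2, so y is a root of the monic polynomial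
   Y^2 + (2 d + e b) Y + (a c + e b d + d^2).  From then on a = 1, the
   discriminant is invariant, d is the residue of - e b modulo p, and x is
   determined by (b, c), being the only root of X^2 + b X + c in pZ_p.  The
   values of b stay bounded (Algorithms B and C) or have period 2 (Algorithm A),
   so some image of x recurs. *)
From HB Require Import structures.
Require Import Defs.
From mathcomp Require Import all_boot all_order all_algebra.
From mathcomp Require Import boolp classical_sets cardinality fsbigop finmap.
From mathcomp Require Import zify ring.

Set Implicit Arguments.
Unset Strict Implicit.
Unset Printing Implicit Defensive.

Import Order.TTheory GRing.Theory Num.Theory.
Local Open Scope ring_scope.

(** * p-adic integers *)

Section PadicIntegers.
Variables (p : nat) (p_pr : prime p).
Implicit Types x y : padic_int p_pr.

Lemma padic_res_intr (z : int) n : (z%:~R : padic_int p_pr) n = (z %% (p ^ n)%N)%Z.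
Proof.
have nat_case (k : nat) : (k%:R : padic_int p_pr) = padic_cst p_pr k.
  elim: k => [//|k IHk]; rewrite -addn1 natrD IHk.
  by apply: padic_intP => m /=; rewrite modzDm -PoszD.
case: z => k; rewrite ?NegzE ?mulrNz -pmulrn nat_case //=.
by rewrite modzNm.
Qed.

Lemma expp_gt0 n : (0 < p ^ n)%N. Proof. by rewrite expn_gt0 prime_gt0. Qed.

(** Bezout coefficients of the residues against [p ^ n] invert them level by level; they are
    coherent because an inverse modulo [p ^ m] is unique. *)
Lemma padic_int_unitE x : (x \is a GRing.unit) = ~~ (p %| x 1%N)%Z.
Proof.
apply/idP/idP => [/unitrPr [y /(congr1 (fun z : padic_int p_pr => z 1%N))] /= xy1|ndiv].
  apply/negP => /dvdz_mod0P x0; move: xy1.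
  rewrite expn1 -modzMml x0 mul0r mod0z modz_small //.
  by rewrite ltz_nat prime_gt1.
have cop n : coprimez (x n) (p ^ n)%N.
  case: n => [|n]; first by rewrite expn0 coprimezE coprimen1.
  rewrite coprimezE coprime_pexpr // coprime_sym prime_coprime //.
  have := padic_res_mod x (isT : (1 <= n.+1)%N); rewrite expn1 => e.
  apply: contra ndiv; rewrite -[(p %| _)%N]/(p %| x n.+1)%Z => /dvdz_mod0P h.
  by apply/dvdz_mod0P; rewrite e.
pose y n := (egcdz (x n) (p ^ n)%N).1.
have yx n : (y n * x n = 1 %[mod (p ^ n)%N])%Z.
  rewrite /y; case: egcdzP => u v /= uv _.
  move: (cop n); rewrite /coprimez => /eqP h; rewrite h in uv.
  by rewrite -uv addrC modzMDl.
have coh m n : (m <= n)%N -> (y m = y n %[mod (p ^ m)%N])%Z.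
  move=> le; apply/eqP; rewrite eqz_mod_dvd.
  have cop' : coprimez (p ^ m)%N (x m) by rewrite coprimez_sym cop.
  rewrite -(Gauss_dvdzr (y m - y n) cop').
  rewrite mulrBr -eqz_mod_dvd mulrC yx; apply/eqP.
  rewrite -modzMml (padic_res_mod x le) modzMml mulrC.
  have := yx n => /eqP; rewrite eqz_mod_dvd => h.
  apply/esym/eqP; rewrite eqz_mod_dvd; apply: dvdz_trans h.
  by rewrite dvdzE /= dvdn_exp2l.
apply/unitrPr; exists (padic_of p_pr coh); apply: padic_intP => n /=.
by rewrite modzMmr mulrC yx.
Qed.

Lemma padic_int_factor x : x != 0 ->
  exists n w, w \is a GRing.unit /\ x = p%:R ^+ n * w.
Proof.
move=> /padic_int_neq0 ex; case: (ex_minnP ex) => [[|k]].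
  by rewrite expn0 dvd1z.
move=> ndiv min; have divk : ((p ^ k)%N %| x k)%Z.
  by apply: contraT => /min; rewrite ltnn.
have divn n : ((p ^ k)%N %| x (n + k)%N)%Z by rewrite padic_dvd_res ?leq_addl.
have pk0 : (p ^ k)%N%:Z != 0 by have := expp_gt0 k; lia.
(* Here [k] is the last level where the residue of [x] vanishes. A residue modulo [p ^ (n + k)]
   divided by [p ^ k] is determined only modulo [p ^ n], whence the index shift. *)
pose w n := (x (n + k)%N %/ (p ^ k)%N)%Z.
have wE n : w n * (p ^ k)%N = x (n + k)%N by rewrite divzK.
have coh m n : (m <= n)%N -> (w m = w n %[mod (p ^ m)%N])%Z.
  move=> le; apply/eqP; rewrite eqz_mod_dvd -(dvdz_mul2r pk0) mulrBl !wE.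
  have le' : (m + k <= n + k)%N by rewrite leq_add2r.
  by rewrite -PoszM -expnD -eqz_mod_dvd (padic_res_mod x le').
exists k, (padic_of p_pr coh); split.
  rewrite padic_int_unitE /= expn1; apply: contra ndiv => /dvdz_mod0P.
  rewrite modz_mod => /dvdz_mod0P; rewrite -(dvdz_mul2r pk0) wE.
  by rewrite -PoszM -expnS.
apply: padic_intP => n; rewrite -natrX [_%:R]pmulrn /= padic_res_intr.
rewrite modzMml modzMmr mulrC wE -[LHS]padic_res_id.
by rewrite (padic_res_mod x (leq_addr k n)).
Qed.

End PadicIntegers.

(** * Valuation and integrality in Q_p *)

Lemma tofrac_surj (R : idomainType) (x : {fraction R}) :
  exists n d : R, d != 0 /\ x = FracField.tofrac n / FracField.tofrac d.
Proof.
elim/quotW: x => r; exists (\n_r), (\d_r); split; first exact: denom_ratioP.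
have d0 : FracField.tofrac \d_r != 0.
  by rewrite tofrac_eq0 denom_ratioP.
apply: (canRL (mulfK d0)); rewrite /GRing.mul /= !piE /FracField.mulf.
apply/eqmodP; rewrite /= FracField.equivfE.
by rewrite !numden_Ratio ?mulr1 ?oner_eq0 ?denom_ratioP // mulrC.
Qed.

(** The alias [padic_of_int] hides [tofrac]; this gives it back its ring morphism structure. *)
HB.instance Definition _ (p : nat) (p_pr : prime p) :=
  GRing.RMorphism.copy (@padic_of_int p p_pr)
    (@FracField.tofrac (padic_int p_pr)).

Section PadicField.
Variables (p : nat) (p_pr : prime p).
Local Notation Qp := (padic p_pr).
Local Notation iota := (@padic_of_int p p_pr).
Implicit Types x y : Qp.

Lemma padic_of_int_inj : injective iota.
Proof. by move=> a b /eqP; rewrite /padic_of_int tofrac_eq => /eqP. Qed.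

Lemma padic_of_int_eq0 a : (iota a == 0) = (a == 0).
Proof. exact: tofrac_eq0. Qed.

(** At level [|z|] the modulus exceeds [|z|], so a nonzero [z] cannot vanish there. *)
Lemma padic_int_intr_neq0 (z : int) : z != 0 -> (z%:~R : padic_int p_pr) != 0.
Proof.
move=> z0; apply/eqP => /(congr1 (fun a : padic_int p_pr => a `|z|%N)).
rewrite padic_res_intr /= mod0z => /dvdz_mod0P.
rewrite dvdzE /= => /dvdn_leq; rewrite absz_gt0 z0 => /(_ isT).
by have := ltn_expl `|z| (prime_gt1 p_pr); lia.
Qed.

Lemma padic_intr_neq0 (z : int) : z != 0 -> (z%:~R : Qp) != 0.
Proof.
by move=> z0; rewrite -(rmorph_int iota) padic_of_int_eq0 padic_int_intr_neq0.
Qed.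

Lemma padic_intr_inj (m n : int) : (m%:~R : Qp) = n%:~R -> m = n.
Proof.
move=> mn; apply/eqP; rewrite -subr_eq0; apply: contraT => /padic_intr_neq0.
by rewrite rmorphB /= mn subrr eqxx.
Qed.

Lemma padic_p_neq0 : (p%:R : Qp) != 0.
Proof. by rewrite pmulrn padic_intr_neq0 //; have := prime_gt0 p_pr; lia. Qed.

Lemma padic_factor x : x != 0 ->
  exists k w, w \is a GRing.unit /\ x = p%:R ^ k * iota w.
Proof.
have [n [d [d0 ->]]] := tofrac_surj x; rewrite -!/(padic_of_int _).
move=> nd0; have n0 : n != 0.
  by apply: contraNneq nd0 => ->; rewrite rmorph0 mul0r.
have [i [u [uU ->]]] := padic_int_factor n0.
have [j [v [vU ->]]] := padic_int_factor d0.
exists (i%:Z - j%:Z), (u / v); split; first by rewrite unitrM uU unitrV vU.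
have iv0 : iota v != 0.
  by rewrite padic_of_int_eq0; apply: contraTneq vU => ->; rewrite unitr0.
rewrite expfzDr ?padic_p_neq0 // !rmorphM !rmorphXn rmorph_nat -exprnN -exprnP /=.
have -> : iota v^-1 = (iota v)^-1.
  by apply: (mulIf iv0); rewrite mulVf // -rmorphM mulVr // rmorph1.
by rewrite !invfM; ring.
Qed.

Lemma padic_valE (k : int) (w : padic_int p_pr) : w \is a GRing.unit ->
  padic_val (p%:R ^ k * iota w) = k.
Proof.
move=> wU; apply: xget_unique; first by exists w.
(* If the exponents differed, cancelling the smaller power of [p] would make a unit divisible by
   [p]. *)
have aux (i j : int) (u v : padic_int p_pr) : v \is a GRing.unit ->
    p%:R ^ i * iota u = p%:R ^ j * iota v -> ~ (j < i).
  move=> vU e lt; have [n ij] : exists n : nat, i = j + n.+1%:Z.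
    by exists `|i - j|.-1%N; lia.
  move: e; rewrite ij expfzDr ?padic_p_neq0 // -mulrA.
  move/(mulfI (expfz_neq0 j padic_p_neq0)).
  rewrite -exprnP -(rmorph_nat iota) -rmorphXn -rmorphM => /padic_of_int_inj e.
  move: vU; rewrite padic_int_unitE -e exprS -mulrA.
  rewrite [p%:R]pmulrn /= padic_res_intr expn1 modzz mul0r mod0z.
  by rewrite dvdz0.
move=> l [v vU e]; apply/eqP; rewrite eq_le; apply/andP; split; rewrite leNgt.
- by apply/negP; apply: aux wU (esym e).
- by apply/negP; apply: aux vU e.
Qed.

Lemma padic_valP x : x != 0 ->
  exists w, w \is a GRing.unit /\ x = p%:R ^ (padic_val x) * iota w.
Proof.
by move=> /padic_factor[k [w [wU ->]]]; rewrite padic_valE //; exists w.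
Qed.

Lemma padic_valM x y : x != 0 -> y != 0 ->
  padic_val (x * y) = padic_val x + padic_val y.
Proof.
move=> /padic_valP[u [uU ex]] /padic_valP[v [vU ey]].
rewrite [in LHS]ex [in LHS]ey mulrACA -rmorphM -expfzDr ?padic_p_neq0 //.
by rewrite padic_valE // unitrM uU.
Qed.

Lemma padic_val1 : padic_val (1 : Qp) = 0.
Proof.
have := @padic_valE 0 1 (unitr1 _).
by rewrite rmorph1 mulr1 expr0z.
Qed.

Lemma padic_valV x : x != 0 -> padic_val x^-1 = - padic_val x.
Proof.
move=> x0; apply/eqP; rewrite -addr_eq0; apply/eqP; rewrite -padic_val1.
by rewrite -(mulVf x0) padic_valM ?invr_eq0.
Qed.

Lemma padic_valN x : padic_val (- x) = padic_val x.
Proof.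
have [->|x0] := eqVneq x 0; first by rewrite oppr0.
have [w [wU e]] := padic_valP x0.
by rewrite [in LHS]e -mulrN -rmorphN padic_valE // unitrN.
Qed.

Lemma padic_val_expp (k : int) : padic_val (p%:R ^ k : Qp) = k.
Proof. by have := @padic_valE k 1 (unitr1 _); rewrite rmorph1 mulr1. Qed.

Definition in_Zp x := exists a, x = iota a.

Lemma in_ZpP x : in_Zp x <-> x = 0 \/ 0 <= padic_val x.
Proof.
have [->|x0] := eqVneq x 0.
  by split => _; [left | exists 0; rewrite rmorph0].
split=> [[a ax]|[/eqP|]]; [right|by rewrite (negPf x0)|].
  have a0 : a != 0 by move: x0; rewrite ax padic_of_int_eq0.
  have [n [w [wU e]]] := padic_int_factor a0.
  by rewrite ax e rmorphM rmorphXn rmorph_nat exprnP padic_valE.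
have [w [wU e]] := padic_valP x0; case vx: (padic_val x) => [n|//] _.
by exists (p%:R ^+ n * w); rewrite e vx rmorphM rmorphXn rmorph_nat exprnP.
Qed.

Lemma in_pZpE x : in_pZp x <-> in_Zp (x / p%:R).
Proof.
split=> -[a e]; exists a; first by rewrite e mulrC mulKf ?padic_p_neq0.
by rewrite -e mulrC divfK ?padic_p_neq0.
Qed.

(** Zero is listed apart because [padic_val 0] takes the default value 0, which is not positive. *)
Lemma in_pZpP x : in_pZp x <-> x = 0 \/ 0 < padic_val x.
Proof.
have [->|x0] := eqVneq x 0.
  by split => _; [left | exists 0; rewrite rmorph0 mulr0].
have p0 := padic_p_neq0; have ip0 : (p%:R : Qp)^-1 != 0 by rewrite invr_eq0.
have xp0 : x / p%:R != 0 := mulf_neq0 x0 ip0.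
rewrite in_pZpE in_ZpP (padic_valM x0 ip0) (padic_valV p0).
have := padic_val_expp 1; rewrite expr1z => ->.
by split=> -[/eqP|]; rewrite ?(negPf x0) ?(negPf xp0) // => ?; right; lia.
Qed.

Lemma in_ZpD x y : in_Zp x -> in_Zp y -> in_Zp (x + y).
Proof. by move=> [a ->] [b ->]; exists (a + b); rewrite rmorphD. Qed.

Lemma in_ZpM x y : in_Zp x -> in_Zp y -> in_Zp (x * y).
Proof. by move=> [a ->] [b ->]; exists (a * b); rewrite rmorphM. Qed.

Lemma in_ZpN x : in_Zp x -> in_Zp (- x).
Proof. by move=> [a ->]; exists (- a); rewrite rmorphN. Qed.

Lemma in_Zp_int (z : int) : in_Zp z%:~R.
Proof. by exists z%:~R; rewrite rmorph_int. Qed.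

Lemma in_pZpD x y : in_pZp x -> in_pZp y -> in_pZp (x + y).
Proof. by move=> [a ->] [b ->]; exists (a + b); rewrite rmorphD mulrDr. Qed.

Lemma in_pZpN x : in_pZp x -> in_pZp (- x).
Proof. by move=> [a ->]; exists (- a); rewrite rmorphN mulrN. Qed.

Lemma in_pZpB x y : in_pZp x -> in_pZp y -> in_pZp (x - y).
Proof. by move=> hx hy; apply: in_pZpD => //; apply: in_pZpN. Qed.

Lemma in_pZpMl x y : in_Zp x -> in_pZp y -> in_pZp (x * y).
Proof. by move=> [a ->] [b ->]; exists (a * b); rewrite rmorphM mulrCA. Qed.

Lemma in_pZpW x : in_pZp x -> in_Zp x.
Proof. by move=> [a ->]; exists (p%:R * a); rewrite rmorphM rmorph_nat. Qed.

Lemma in_pZp_of_int (a : padic_int p_pr) : in_pZp (iota a) <-> (p %| a 1%N)%Z.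
Proof.
split=> [[b]|].
  rewrite -(rmorph_nat iota) -rmorphM => /padic_of_int_inj ->.
  by rewrite pmulrn /= padic_res_intr expn1 modzz mul0r mod0z dvdz0.
move=> div; rewrite in_pZpP.
have [->|a0] := eqVneq a 0; first by left; rewrite rmorph0.
have [[|n] [w [wU e]]] := padic_int_factor a0.
  by move: wU; rewrite padic_int_unitE -[w]mul1r -[1 * w]e div.
by right; rewrite e rmorphM rmorphXn rmorph_nat exprnP padic_valE.
Qed.

Lemma in_pZp_int (z : int) : in_pZp (z%:~R : Qp) <-> (p %| z)%Z.
Proof.
rewrite -(rmorph_int iota) in_pZp_of_int padic_res_intr expn1.
by split=> /dvdz_mod0P; rewrite ?modz_mod => /dvdz_mod0P // h;
  apply/dvdz_mod0P; rewrite ?modz_mod; apply/dvdz_mod0P.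
Qed.

Lemma padic_val_int_eq0 (z : int) : ~~ (p %| z)%Z -> padic_val (z%:~R : Qp) = 0.
Proof.
move=> ndiv; have := in_Zp_int z; rewrite in_ZpP.
have: ~ in_pZp (z%:~R : Qp) by rewrite in_pZp_int; apply/negP.
by rewrite in_pZpP => h [/[dup] z0|]; [case: h; left | lia].
Qed.

Lemma in_Zp_residue x : in_Zp x -> exists2 d : nat, (d < p)%N & in_pZp (x - d%:R).
Proof.
move=> [a ->]; have p0 : p%:Z != 0 by have := prime_gt0 p_pr; lia.
exists `|(a 1%N %% p)%Z|%N.
  by have := ltz_mod (a 1%N) p0; have := modz_ge0 (a 1%N) p0; lia.
rewrite pmulrn gez0_abs ?modz_ge0 // -(rmorph_int iota) -rmorphB.
rewrite in_pZp_of_int /= padic_res_intr expn1 modz_mod modzNm.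
by apply/dvdz_mod0P; rewrite modz_mod modzDmr subrr mod0z.
Qed.

End PadicField.

(** * Minimal polynomials and conjugates *)

(** The second root is rational in the first, so the conjugate of a quadratic element of Q_p lies in
    Q_p and no extension has to be formed. *)
Lemma vieta (F : fieldType) (a b c x : F) : a != 0 ->
  a * x ^+ 2 + b * x + c = 0 ->
  a * (x + (- b / a - x)) = - b /\ a * (x * (- b / a - x)) = c.
Proof.
move=> a0 rt; split; first by field.
by apply/eqP; rewrite -subr_eq0 -oppr_eq0; apply/eqP; rewrite -rt; field.
Qed.

Section Quadratic.
Variables (p : nat) (p_pr : prime p).
Local Notation Qp := (padic p_pr).
Implicit Types x y : Qp.

Definition irrational x := forall m n : int, m%:~R * x + n%:~R = 0 -> m = 0.

(** Vieta's relations for the two roots of [a X^2 + b X + c]; in this form every change of variable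
    becomes a polynomial identity. *)
Definition quad_roots (a b c : int) x x' :=
  a%:~R * (x + x') = - b%:~R /\ a%:~R * (x * x') = c%:~R.

Lemma quad_roots_eq0 a b c x x' : quad_roots a b c x x' ->
  a%:~R * x ^+ 2 + b%:~R * x + c%:~R = 0.
Proof.
move=> [s <-]; have -> : b%:~R = - (a%:~R * (x + x')) by rewrite s opprK.
by ring.
Qed.

Lemma irrational_neq0 x : irrational x -> x != 0.
Proof.
by move=> irr; apply/eqP => x0; have := irr 1 0; rewrite x0 mulr0 addr0 => /(_ erefl).
Qed.

(** A double root or a zero conjugate would turn the sum relation into an integral linear equation
    for [x]. *)
Lemma quad_roots_neq a b c x x' : irrational x -> a != 0 ->
  quad_roots a b c x x' -> x' != x /\ x' != 0.
Proof.
move=> irr a0 [s _]; split; apply: contraNneq a0 => e; move: s; rewrite e.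
  move=> /eqP; rewrite -subr_eq0 opprK => /eqP e'.
  have /eqP : a *+ 2 = 0 by apply: (irr _ b); rewrite -[RHS]e' rmorphMn /=; ring.
  by rewrite mulrn_eq0.
rewrite addr0 => /eqP; rewrite -subr_eq0 opprK => /eqP /irr ->.
by [].
Qed.

Lemma horner_intr3 (q : {poly int}) x : (size q <= 3)%N ->
  (map_poly intr q).[x] = (q`_2)%:~R * x ^+ 2 + (q`_1)%:~R * x + (q`_0)%:~R.
Proof.
move=> sz; rewrite (@horner_coef_wide _ 3); last exact: leq_trans (size_poly _ _) sz.
rewrite !big_ord_recl big_ord0 /= !coef_map /= /bump /=.
by rewrite expr0 expr1 !mulr1 addr0; ring.
Qed.

Lemma annihilates_size (q : {poly int}) x : irrational x -> annihilates q x ->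
  (3 <= size q)%N.
Proof.
move=> irr /andP[q0 /rootP]; rewrite ltnNge; apply/contraPN => sz.
rewrite horner_intr3; last exact: leq_trans sz _.
rewrite [q`_2]nth_default // mul0r add0r => e; have q1 := irr _ _ e.
move: e; rewrite q1 mul0r add0r => e; have q00 := @padic_intr_inj p p_pr _ 0 e.
case/eqP: q0; apply/polyP => -[|[|i]]; rewrite coef0 //.
by rewrite nth_default // (leq_trans sz).
Qed.

Lemma is_minpoly_ex a b c x x' : irrational x -> a != 0 ->
  quad_roots a b c x x' -> exists q, is_minpoly q x /\ size q = 3%N.
Proof.
move=> irr a0 /quad_roots_eq0 e; pose r := Poly [:: c; b; a].
have rE : r = [:: c; b; a] :> seq int by apply: (@PolyK _ 0).
have r0 : r != 0 by rewrite -size_poly_eq0 rE.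
have [szr szq] : size r = 3%N /\ size (zprimitive r) = 3%N.
  by rewrite size_zprimitive rE.
(* The primitive part has content one and positive leading coefficient; irrationality of [x]
   excludes smaller sizes. *)
exists (zprimitive r); split=> //.
have q0 : zprimitive r != 0 by rewrite zprimitive_eq0.
split.
- rewrite /annihilates q0 /=.
  have : root (map_poly intr r) x by apply/rootP; rewrite horner_intr3 ?szr // rE.
  rewrite {1}(zpolyEprim r) map_polyZ rootZ //.
  by rewrite padic_intr_neq0 // zcontents_eq0.
- by move=> s /(annihilates_size irr); rewrite szq.
- by rewrite -sgz_gt0 sgz_lead_primitive r0.
- by rewrite zcontents_primitive r0.
Qed.

(** Eliminating the square between the given equation and the minimal one leaves a linear relation,
    whose coefficients vanish by irrationality. The two equations are thus proportional and share
    the conjugate. *)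
Lemma minpolyP a b c x x' : irrational x -> a != 0 -> quad_roots a b c x x' ->
  [/\ is_minpoly (minpoly x) x, size (minpoly x) = 3%N, 0 < (minpoly x)`_2 &
      quad_roots (minpoly x)`_2 (coef_b x) (coef_c x) x x'].
Proof.
move=> irr a0 rts; have [r [mr szr]] := is_minpoly_ex irr a0 rts.
have mq : is_minpoly (minpoly x) x.
  by apply: (@xgetPex _ 0 [set q | is_minpoly q x]%classic); exists r.
rewrite /coef_b /coef_c; set q := minpoly x in mq *.
have [ann min lead _] := mq; have sz : size q = 3%N.
  apply: anti_leq; rewrite (annihilates_size irr ann) andbT -szr.
  by case: mr => annr _ _ _; exact: min.
move: ann => /andP[_ /rootP]; rewrite horner_intr3 ?sz // => eq.
have ea := quad_roots_eq0 rts.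
have [e1 e0] : a * q`_1 - q`_2 * b = 0 /\ a * q`_0 - q`_2 * c = 0.
  have e : (a * q`_1 - q`_2 * b)%:~R * x + (a * q`_0 - q`_2 * c)%:~R = 0.
    rewrite !rmorphB !rmorphM /=; set A := a%:~R; set B := b%:~R.
    have -> : 0 = A * 0 - (q`_2)%:~R * 0 :> Qp by ring.
    by rewrite -[in A * 0]eq -[in _ * 0]ea; ring.
  have e1 := irr _ _ e; split => //; move: e; rewrite e1 mul0r add0r.
  exact: (@padic_intr_inj p p_pr _ 0).
split=> //; first by move: lead; rewrite lead_coefE sz.
have aQ := @padic_intr_neq0 p p_pr _ a0; case: rts => s m.
split; apply: (mulfI aQ).
  rewrite mulrCA s !mulrN -!rmorphM; congr (- _%:~R).
  by apply/eqP; rewrite eq_sym -subr_eq0 e1.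
rewrite mulrCA m -!rmorphM; congr (_%:~R).
by apply/eqP; rewrite eq_sym -subr_eq0 e0.
Qed.

(** The minimal polynomial is [q_2] times a monic integral polynomial, so its content is [q_2], and
    it is primitive. *)
Lemma minpoly_monic b c x x' : irrational x -> quad_roots 1 b c x x' ->
  [/\ (minpoly x)`_2 = 1, coef_b x = b & coef_c x = c].
Proof.
move=> irr rts; have := minpolyP irr (oner_neq0 _) rts.
rewrite /coef_b /coef_c; set q := minpoly x => -[[_ _ _ cnt] sz q2 [s m]].
case: rts; rewrite !mul1r => s' m'.
have e1 : q`_1 = q`_2 * b.
  apply: (@padic_intr_inj p p_pr); apply: oppr_inj.
  by rewrite -s s' rmorphM mulrN.
have e0 : q`_0 = q`_2 * c.
  by apply: (@padic_intr_inj p p_pr); rewrite -m m' rmorphM.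
pose r : {poly int} := Poly [:: c; b; 1].
have rE : r = [:: c; b; 1] :> seq int by apply: (@PolyK _ 0).
have qr : q = q`_2 *: r.
  apply/polyP => i; rewrite coefZ rE; case: i => [|[|[|i]]] //=.
  - by rewrite mulr1.
  - by rewrite nth_nil mulr0 nth_default // sz.
have q21 : q`_2 = 1.
  move: cnt; rewrite qr zcontentsZ zcontents_monic ?mulr1 //.
    by rewrite -qr.
  by rewrite monicE lead_coefE rE.
by rewrite e1 e0 q21 !mul1r.
Qed.

Lemma minpoly_primitive x : is_minpoly (minpoly x) x -> size (minpoly x) = 3%N ->
  (p %| (minpoly x)`_2)%Z -> (p %| coef_b x)%Z -> ~~ (p %| coef_c x)%Z.
Proof.
rewrite /coef_b /coef_c; set q := minpoly x => -[_ _ _ cnt] sz d2 d1.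
apply/negP => d0; have : (p %| zcontents q)%Z.
  rewrite dvdz_contents; apply/(all_nthP 0) => i; rewrite sz.
  by case: i => [|[|[|i]]].
by rewrite cnt dvdz1 /=; have := prime_gt1 p_pr; lia.
Qed.

Lemma quadraticP x : quadratic x ->
  irrational x /\ exists a b c x', a != 0 /\ quad_roots a b c x x'.
Proof.
move=> [q [/andP[q0 /rootP rt] min lead cnt] sz]; split.
  move=> m n e; apply/eqP; apply: contraT => m0.
  pose r := Poly [:: n; m].
  have rE : r = [:: n; m] :> seq int by apply: (@PolyK _ 0).
  have := min r; rewrite sz rE => h; apply: h.
  rewrite /annihilates -size_poly_eq0 rE /=; apply/rootP.
  by rewrite horner_intr3 ?rE //= mul0r add0r.
have a0 : q`_2 != 0.
  by move: lead; rewrite lead_coefE sz /=; case: ltgtP.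
exists q`_2, q`_1, q`_0, (- (q`_1)%:~R / (q`_2)%:~R - x); split=> //.
move: rt; rewrite horner_intr3 ?sz // => rt.
have aQ := @padic_intr_neq0 p p_pr _ a0.
exact: vieta.
Qed.

End Quadratic.

(** * One step of the algorithms *)

(** Inverting the roots reverses the coefficients, so [c] becomes the leading one. *)
Lemma moebius_vieta (F : fieldType) (a b c x x' s d : F) :
  x != 0 -> x' != 0 -> a * (x + x') = - b -> a * (x * x') = c ->
  c * ((s / x - d) + (s / x' - d)) = - (s * b + 2 * d * c) /\
  c * ((s / x - d) * (s / x' - d)) = s ^+ 2 * a + d * s * b + d ^+ 2 * c.
Proof.
move=> x0 x'0 eb <-; have -> : b = - (a * (x + x')) by rewrite eb opprK.
by split; field; rewrite x0 x'0.
Qed.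

Lemma moebius_sub (F : fieldType) (x x' s d : F) : x != 0 -> x' != 0 ->
  (s / x - d) - (s / x' - d) = s / x * ((x' - x) / x').
Proof. by move=> x0 x'0; field; rewrite x0 x'0. Qed.

(** The products [a x] and [a x'] are the roots of the monic [Z^2 + b Z + a c]; a sign change and a
    shift keep it monic. *)
Lemma unit_vieta (F : fieldType) (a b c e x x' d : F) : e * e = 1 ->
  a * (x + x') = - b -> a * (x * x') = c ->
  (e * (a * x') - d) + (e * (a * x) - d) = - (2 * d + e * b) /\
  (e * (a * x') - d) * (e * (a * x) - d) = a * c + e * b * d + d ^+ 2.
Proof.
move=> ee eb <-; have -> : b = - (a * (x + x')) by rewrite eb opprK.
split; first by ring.
have -> : (e * (a * x') - d) * (e * (a * x) - d) =
  (e * e) * (a * (a * (x * x'))) - e * (a * (x + x')) * d + d ^+ 2 by ring.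
by rewrite ee; ring.
Qed.

Lemma dvdz_sign (d e u : int) : e = 1 \/ e = -1 -> (d %| e * u)%Z = (d %| u)%Z.
Proof. by case=> ->; rewrite ?mulN1r ?mul1r ?rpredN. Qed.

Section Step.
Variables (p : nat) (p_pr : prime p).
Local Notation Qp := (padic p_pr).
Implicit Types x y : Qp.

Definition signed_T (e : int) x : Qp :=
  inv_part (e%:~R * upart x) x - (shift_digit (e%:~R * upart x) x)%:R.

Definition alg_sign alg x : int := if chooses_T2 alg x then -1 else 1.

Lemma alg_sign_cases alg x : alg_sign alg x = 1 \/ alg_sign alg x = -1.
Proof. by rewrite /alg_sign; case: ifP; [right|left]. Qed.

Lemma alg_TE alg x : alg_T alg x = signed_T (alg_sign alg x) x.
Proof.
rewrite /alg_T /alg_sign /signed_T /T1 /T2 /d1 /d2.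
by case: ifP => _; rewrite ?mulN1r ?mul1r.
Qed.

(** [upart] is computed in [rat] through an absolute value; this recovers the integer behind it, the
    part of [c] prime to [p]. *)
Lemma upartP x : coef_c x != 0 ->
  exists (u : int) (m : nat), [/\ coef_c x = u * (p ^ m)%N, ~~ (p %| u)%Z,
    upart x = u%:~R & padic_val ((coef_c x)%:~R : Qp) = m].
Proof.
move=> c0; have [m [w [wU cw]]] := padic_int_factor (padic_int_intr_neq0 p_pr c0).
have divc : ((p ^ m)%N %| coef_c x)%Z.
  move/(congr1 (fun z : padic_int p_pr => z m)): cw => /=.
  rewrite -natrX [_%:R]pmulrn !padic_res_intr modzz mul0r mod0z.
  by move=> /dvdz_mod0P.
have [u uE] : exists u : int, coef_c x = u * (p ^ m)%N.
  by exists (coef_c x %/ (p ^ m)%N)%Z; rewrite divzK.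
have vc : padic_val ((coef_c x)%:~R : Qp) = m.
  rewrite -(rmorph_int (@padic_of_int p p_pr)) cw rmorphM rmorphXn rmorph_nat /=.
  by rewrite exprnP padic_valE.
have p0 : (p%:R : rat) != 0 by rewrite pnatr_eq0; have := prime_gt0 p_pr; lia.
exists u, m; split=> //.
  apply: contraTN wU => du; rewrite padic_int_unitE negbK.
  have -> : w = u%:~R.
    apply: (mulfI (expf_neq0 m (@padic_int_intr_neq0 p p_pr p _))).
      by have := prime_gt0 p_pr; lia.
    by rewrite -[p%:~R]pmulrn -cw uE rmorphM /= mulrC -pmulrn natrX.
  by rewrite padic_res_intr expn1; apply/dvdz_mod0P; rewrite modz_mod; apply/dvdz_mod0P.
rewrite /upart /padic_abs (negPf (padic_intr_neq0 p_pr c0)) vc uE rmorphM /=.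
by rewrite -pmulrn natrX -exprnN mulfK // expf_neq0.
Qed.

Lemma sign_mul (e : int) : e = 1 \/ e = -1 -> e * e = 1.
Proof. by case=> ->. Qed.

(** As [k] is the valuation of [x], the quotient [e u p^k / x] is a p-adic unit. Its residue is
    therefore a nonzero digit, so the choice made by [shift_digit] succeeds. *)
Lemma signed_TP (e : int) x : e = 1 \/ e = -1 -> irrational x -> in_pZp x ->
  coef_c x != 0 ->
  exists (u : int) (m k d : nat),
    [/\ [/\ coef_c x = u * (p ^ m)%N, ~~ (p %| u)%Z &
            padic_val ((coef_c x)%:~R : Qp) = m],
        (0 < k)%N /\ padic_val x = k, (0 < d < p)%N,
        signed_T e x = (e * u * (p ^ k)%N)%:~R / x - d%:R &
        in_pZp (signed_T e x)].
Proof.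
move=> esgn irr xp c0; have [u [m [cE ndiv uE vc]]] := upartP c0.
have x0 := irrational_neq0 irr.
have [k [k0 vx]] : exists k : nat, (0 < k)%N /\ padic_val x = k.
  move: xp; rewrite in_pZpP => -[/eqP|]; first by rewrite (negPf x0).
  by case: (padic_val x) => [k|k] //= k0; exists k.
have invE : inv_part (e%:~R * upart x) x = (e * u * (p ^ k)%N)%:~R / x.
  rewrite /inv_part uE -rmorphM ratr_int vx -exprnP [in RHS]rmorphM /=.
  by rewrite -[((p ^ k)%N)%:~R]pmulrn natrX.
have eu0 : ~~ (p %| e * u)%Z by rewrite dvdz_sign.
have z0 : (e * u * (p ^ k)%N)%:~R / x != 0.
  apply: mulf_neq0 (invr_neq0 x0); apply: padic_intr_neq0; apply: mulf_neq0.
    by apply: contraNneq eu0 => ->; rewrite dvdz0.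
  by have := expp_gt0 p_pr k; lia.
have vz : padic_val ((e * u * (p ^ k)%N)%:~R / x) = 0.
  have eu1 : (e * u)%:~R != 0 :> Qp.
    by apply: padic_intr_neq0; apply: contraNneq eu0 => ->; rewrite dvdz0.
  have pk1 := expfz_neq0 k (padic_p_neq0 p_pr).
  have xi := invr_neq0 x0.
  rewrite rmorphM /= -[((p ^ k)%N)%:~R]pmulrn natrX exprnP.
  rewrite (padic_valM (mulf_neq0 eu1 pk1) xi) (padic_valM eu1 pk1).
  by rewrite (padic_valV x0) padic_val_expp (padic_val_int_eq0 p_pr eu0) vx; lia.
have exd : exists d : nat,
    (0 < d < p)%N /\ in_pZp (inv_part (e%:~R * upart x) x - d%:R).
  have [|d dp dz] := @in_Zp_residue _ _ ((e * u * (p ^ k)%N)%:~R / x).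
    by apply/in_ZpP; right; rewrite vz.
  exists d; rewrite invE dp andbT; split=> //; rewrite lt0n.
  apply/eqP => d0; move: dz; rewrite d0 subr0 in_pZpP vz.
  by case=> [/eqP|//]; rewrite (negPf z0).
pose D := [set d : nat | (0 < d < p)%N /\
                         in_pZp (inv_part (e%:~R * upart x) x - d%:R)]%classic.
have [dlt din] : D (shift_digit (e%:~R * upart x) x) := @xgetPex _ 0%N D exd.
exists u, m, k, (shift_digit (e%:~R * upart x) x).
by split=> //; rewrite /signed_T invE.
Qed.

Lemma irrational_moebius x (s d : int) : irrational x -> s != 0 ->
  irrational (s%:~R / x - d%:~R).
Proof.
move=> irr s0 m n; have x0 := irrational_neq0 irr.
move=> /(congr1 (fun z => z * x)); rewrite mul0r mulrDl mulrBr mulrBl -!mulrA.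
rewrite mulVf // mulr1 => e.
have e' : (n - m * d)%:~R * x + (m * s)%:~R = 0.
  by rewrite -[RHS]e !(rmorphM, rmorphB) /=; ring.
move: (e'); rewrite (irr _ _ e') mul0r add0r.
move=> /(@padic_intr_inj p p_pr _ 0)/eqP.
by rewrite mulf_eq0 (negPf s0) orbF => /eqP.
Qed.

(** If [p] divided [b], then [a x' = - b - a x] would lie in pZ_p. For [p] dividing [a] this makes
    [c = a x x'] divisible too, against primitivity; otherwise [a] is a unit and [x'] itself lies in
    pZ_p. *)
Lemma conj_notin_pZp x x' : is_minpoly (minpoly x) x -> size (minpoly x) = 3%N ->
  quad_roots (minpoly x)`_2 (coef_b x) (coef_c x) x x' ->
  in_pZp x -> ~ in_pZp x' -> ~~ (p %| coef_b x)%Z.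
Proof.
move=> mq sz [s m] xp x'p; apply/negP => db.
set a := (minpoly x)`_2 in s m.
have ax' : in_pZp (a%:~R * x').
  have -> : a%:~R * x' = - (coef_b x)%:~R - a%:~R * x by rewrite -s; ring.
  apply: in_pZpB; first by apply/in_pZpN/in_pZp_int.
  exact: in_pZpMl (in_Zp_int _ _) xp.
have [da|nda] := boolP (p %| a)%Z.
  have := minpoly_primitive mq sz da db; apply/negP; rewrite negbK.
  apply/(in_pZp_int p_pr); rewrite -m mulrCA.
  by apply: in_pZpMl ax'; apply: in_pZpW.
apply: x'p; have [->|x'0] := eqVneq x' 0.
  by apply/in_pZpP; left.
have a0 : a%:~R != 0 :> Qp.
  by apply: padic_intr_neq0; apply: contraNneq nda => ->; rewrite dvdz0.
move: ax'; rewrite !in_pZpP (padic_valM a0 x'0) (padic_val_int_eq0 p_pr nda) add0r.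
by case=> [/eqP|]; [rewrite mulf_eq0 (negPf a0) (negPf x'0)|right].
Qed.

Lemma coef_c_neq0 a b c x x' : irrational x -> a != 0 -> quad_roots a b c x x' ->
  c != 0.
Proof.
move=> irr a0 rts; have [_ x'0] := quad_roots_neq irr a0 rts.
apply/eqP => c0; case: rts => _ /eqP; rewrite c0 !mulf_eq0.
by rewrite (negPf (irrational_neq0 irr)) (negPf x'0) (negPf (padic_intr_neq0 p_pr a0)).
Qed.

Lemma signed_T_conj (e : int) a b c x x' : e = 1 \/ e = -1 ->
  irrational x -> in_pZp x -> a != 0 -> quad_roots a b c x x' ->
  let y := signed_T e x in
  [/\ irrational y, in_pZp y &
      exists a1 b1 c1 y', [/\ a1 != 0, quad_roots a1 b1 c1 y y' &
        padic_val (y - y') = padic_val (x - x') - padic_val x']].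
Proof.
move=> esgn irr xp a0 rts y.
have [_ _ _ rts'] := minpolyP irr a0 rts.
have x0 := irrational_neq0 irr; have [xx' x'0] := quad_roots_neq irr a0 rts.
have cx0 : coef_c x != 0.
  by case: (minpolyP irr a0 rts) => _ _ q2 r; apply: coef_c_neq0 irr _ r; case: ltgtP q2.
have c0 := coef_c_neq0 irr a0 rts.
have [u [m [k [d [[_ ndu _] [k0 vx] _ yE yp]]]]] := signed_TP esgn irr xp cx0.
have neu : ~~ (p %| e * u)%Z by rewrite dvdz_sign.
have eu0 : e * u != 0 by apply: contraNneq neu => ->; rewrite dvdz0.
set S := e * u * (p ^ k)%N in yE.
have pk0 : (p ^ k)%N%:Z != 0 by have := expp_gt0 p_pr k; lia.
have S0 : S != 0 by rewrite mulf_neq0.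
rewrite pmulrn in yE.
split=> //; first by rewrite /y yE; exact: irrational_moebius.
case: (rts) => s mm; have [s1 m1] := moebius_vieta S%:~R d%:~R x0 x'0 s mm.
(* The coefficients come from [moebius_vieta] with [s = S]. *)
exists c, (S * b + 2 * d%:Z * c), (S ^+ 2 * a + d%:Z * S * b + d%:Z ^+ 2 * c).
exists (S%:~R / x' - d%:~R); split=> //.
  rewrite /y yE; split.
    by rewrite s1 !(rmorphD, rmorphM) /=.
  by rewrite m1 !(rmorphD, rmorphM, rmorphXn) /=.
(* [S / x] is a unit by the choice of [k], so only [(x' - x) / x'] contributes to the valuation. *)
rewrite /y yE (moebius_sub _ _ x0 x'0).
have SQ := padic_intr_neq0 p_pr S0.
have x'x : x' - x != 0 by rewrite subr_eq0.
have xi := invr_neq0 x0.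
have x'i := invr_neq0 x'0.
rewrite (padic_valM (mulf_neq0 SQ xi) (mulf_neq0 x'x x'i)).
rewrite (padic_valM SQ xi) (padic_valM x'x x'i) (padic_valV x0) (padic_valV x'0).
rewrite -[in RHS](padic_valN (x - x')) opprB.
rewrite /S rmorphM /= (padic_valM (padic_intr_neq0 p_pr eu0) (padic_intr_neq0 p_pr pk0)).
rewrite (padic_val_int_eq0 p_pr neu) -[((p ^ k)%N)%:~R]pmulrn natrX exprnP.
by rewrite padic_val_expp vx add0r subrr add0r.
Qed.

(** As [b] is prime to [p], [a x' = - b - a x] is a unit, so [c = a x x'] has the valuation of [x].
    Thus [u p^k] is [c] itself, and dividing it by [x] leaves [a x']. *)
Lemma signed_T_unit (e : int) x x' : e = 1 \/ e = -1 ->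
  let a := (minpoly x)`_2 in let b := coef_b x in let c := coef_c x in
  irrational x -> in_pZp x -> a != 0 -> quad_roots a b c x x' -> ~~ (p %| b)%Z ->
  let y := signed_T e x in
  exists (d : nat) y', [/\ (0 < d < p)%N, (p %| d%:Z + e * b)%Z, irrational y, in_pZp y &
    quad_roots 1 (2 * d%:Z + e * b) (a * c + e * b * d%:Z + d%:Z ^+ 2) y y'].
Proof.
move=> esgn a b c irr xp a0 rts nb y.
have x0 := irrational_neq0 irr; have [xx' x'0] := quad_roots_neq irr a0 rts.
have c0 := coef_c_neq0 irr a0 rts.
have [u [m [k [d [[cE ndu vc] [k0 vx] dp yE yp]]]]] := signed_TP esgn irr xp c0.
have [irry _ _] := signed_T_conj esgn irr xp a0 rts.
have aQ := padic_intr_neq0 p_pr a0.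
have [s mm] := rts.
have ax'E : a%:~R * x' = - b%:~R - a%:~R * x by rewrite -s; ring.
have vax' : padic_val (a%:~R * x') = 0.
  have : ~ in_pZp (a%:~R * x').
    move=> h; move/negP: nb; apply; apply/(in_pZp_int p_pr).
    have -> : b%:~R = - (a%:~R * x') - a%:~R * x by rewrite ax'E; ring.
    by apply: in_pZpB; [apply: in_pZpN|apply: in_pZpMl => //; apply: in_Zp_int].
  have : in_Zp (a%:~R * x').
    rewrite ax'E; apply: in_ZpD; first by apply/in_ZpN/in_Zp_int.
    by apply/in_ZpN/in_ZpM; [apply: in_Zp_int|apply: in_pZpW].
  rewrite in_ZpP in_pZpP => -[->|]; first by case; left.
  by move=> h1 h2; case: ltgtP h1 => // h _; case: h2; right.
have mk : m = k.
  move: vc; rewrite -/c -mm mulrCA (padic_valM x0 (mulf_neq0 aQ x'0)) vax' vx.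
  by lia.
have ee := sign_mul esgn.
have yE' : y = e%:~R * (a%:~R * x') - d%:~R.
  rewrite /y yE pmulrn -mulrA -mk -cE rmorphM /= -/c -mm; congr (_ - _).
  by rewrite -mulrA; congr (_ * _); rewrite mulrCA mulrC; exact: mulKf x0 _.
have eeQ : e%:~R * e%:~R = 1 :> Qp by rewrite -rmorphM ee.
have [s1 m1] := unit_vieta d%:~R eeQ s mm.
exists d, (e%:~R * (a%:~R * x) - d%:~R); split=> //.
  (* Eliminating [x'] from [y] expresses [d + e b] through [y] and [a x], both in pZ_p. *)
  apply/(in_pZp_int p_pr); rewrite rmorphD rmorphM /=.
  have -> : d%:~R + e%:~R * b%:~R = - y - e%:~R * (a%:~R * x) :> Qp.
    by rewrite yE' ax'E; ring.
  by apply: in_pZpB; [apply: in_pZpN|do 2![apply: in_pZpMl; first exact: in_Zp_int]].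
rewrite yE'; split; rewrite mul1r.
  by rewrite s1 !(rmorphD, rmorphM) /=.
by rewrite m1 !(rmorphD, rmorphM, rmorphXn) /=.
Qed.

End Step.

(** * Recurrence *)

Lemma dvdz_small (p d : nat) : (0 < d < p)%N -> ~~ (p %| d%:Z)%Z.
Proof.
by move=> /andP[d0 dp]; apply/negP => /dvdn_leq h; have := h d0; lia.
Qed.

Lemma dvdz_sub_small (p d d' : nat) : (0 < d < p)%N -> (0 < d' < p)%N ->
  (p %| d%:Z - d'%:Z)%Z -> d = d'.
Proof.
move=> /andP[_ dp] /andP[_ d'p] /dvdzP[q e].
have q0 : q = 0.
  case: (ltgtP q 0) => // hq; exfalso.
    have : q * p%:Z <= - p%:Z by nia.
    by lia.
  have : p%:Z <= q * p%:Z by nia.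
  by lia.
by move: e; rewrite q0 mul0r; lia.
Qed.

Lemma bounded_int_repeat (f : nat -> int) (B : nat) :
  (forall i, `|f i| <= B%:Z) -> exists i j, (i < j)%N /\ f i = f j.
Proof.
move=> fB; have lt i : (`|(f i + B%:Z)%R|%N < (B + B).+1)%N by have := fB i; lia.
(* Pigeonhole: [2B + 2] indices for the [2B + 1] values, shifted by [B] to be nonnegative. *)
pose g (i : 'I_(B + B).+2) : 'I_(B + B).+1 := Ordinal (lt i).
have /injectivePn[i [j ij gij]] : ~~ injectiveb g.
  by apply/negP => /injectiveP /leq_card; rewrite !card_ord ltnn.
have fij : f i = f j.
  by have := congr1 val gij; rewrite /=; have := fB i; have := fB j; lia.
have /orP[lt_ij|lt_ji] : ((i < j) || (j < i))%N by rewrite -neq_ltn.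
  by exists i, j.
by exists j, i.
Qed.

Section Regime.
Variables (p : nat) (p_pr : prime p).
Local Notation T alg := (@alg_T alg p p_pr).
Local Notation Qp := (padic p_pr).
Implicit Types x y : Qp.

(** The regime in which orbits end: the minimal polynomial is monic with middle coefficient prime to
    [p]. *)
Definition regular x :=
  [/\ irrational x, in_pZp x, ~~ (p %| coef_b x)%Z &
      exists x', quad_roots 1 (coef_b x) (coef_c x) x x'].

Lemma regular_root x : regular x ->
  x ^+ 2 + (coef_b x)%:~R * x + (coef_c x)%:~R = 0.
Proof. by case=> _ _ _ [x' /quad_roots_eq0]; rewrite mul1r. Qed.

(** Subtracting the two equations gives [(x - y)(x + y + b) = 0], and a vanishing second factor
    would put [b] in pZ_p. *)
Lemma regular_inj x y : regular x -> regular y ->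
  coef_b x = coef_b y -> coef_c x = coef_c y -> x = y.
Proof.
move=> rx ry eb ec; have := regular_root ry; rewrite -eb -ec => ey.
have : (x - y) * (x + y + (coef_b x)%:~R) = 0.
  have -> : 0 = 0 - 0 :> Qp by rewrite subrr.
  by rewrite -{1}(regular_root rx) -{1}ey; ring.
move=> /eqP; rewrite mulf_eq0 subr_eq0 => /orP[/eqP//|/eqP e].
case: rx ry => _ xp nb _ [_ yp _ _]; case/negP: nb; apply/(in_pZp_int p_pr).
have -> : (coef_b x)%:~R = - x - y.
  by apply/eqP; rewrite -subr_eq0 -[X in _ == X]e; apply/eqP; ring.
exact: in_pZpB (in_pZpN xp) yp.
Qed.

Lemma signed_T_regular (e : int) x x' : e = 1 \/ e = -1 ->
  let a := (minpoly x)`_2 in let b := coef_b x in let c := coef_c x in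
  irrational x -> in_pZp x -> a != 0 -> quad_roots a b c x x' -> ~~ (p %| b)%Z ->
  let y := signed_T e x in
  regular y /\ exists d : nat, [/\ (0 < d < p)%N, (p %| d%:Z + e * b)%Z,
    coef_b y = 2 * d%:Z + e * b & coef_c y = a * c + e * b * d%:Z + d%:Z ^+ 2].
Proof.
move=> esgn a b c irr xp a0 rts nb y.
have [d [y' [dp db irry yp rtsy]]] := signed_T_unit esgn irr xp a0 rts nb.
have [_ eb ec] := minpoly_monic irry rtsy.
split; last by exists d.
split; [exact: irry|exact: yp| |by rewrite eb ec; exists y'].
rewrite eb.
(* Modulo [p] the new middle coefficient is the nonzero digit [d]. *)
have -> : 2 * d%:Z + e * b = d%:Z + (d%:Z + e * b) by ring.
by rewrite rpredDr // dvdz_small.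
Qed.

Lemma regular_step alg x : regular x -> let e := alg_sign alg x in
  regular (alg_T alg x) /\ exists d : nat, [/\ (0 < d < p)%N,
    (p %| d%:Z + e * coef_b x)%Z,
    coef_b (alg_T alg x) = 2 * d%:Z + e * coef_b x &
    coef_c (alg_T alg x) = coef_c x + e * coef_b x * d%:Z + d%:Z ^+ 2].
Proof.
move=> [irr xp nb [x' rts]] e; rewrite alg_TE.
have [q2 _ _] := minpoly_monic irr rts.
have := @signed_T_regular e x x' (alg_sign_cases alg x) irr xp.
by rewrite q2 mul1r; apply.
Qed.

Definition discriminant x := coef_b x ^+ 2 - 4 * coef_c x.

Lemma discriminant_step alg x : regular x ->
  discriminant (alg_T alg x) = discriminant x.
Proof.
move=> rx; have [_ [d [_ _ eb ec]]] := regular_step alg rx.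
rewrite /discriminant eb ec.
have : alg_sign alg x * alg_sign alg x = 1.
  by rewrite /alg_sign; case: ifP.
move: (alg_sign _ _) => e ee.
have -> : (2 * d%:Z + e * coef_b x) ^+ 2 =
  4 * d%:Z ^+ 2 + 4 * d%:Z * e * coef_b x + (e * e) * coef_b x ^+ 2 by ring.
by rewrite ee; ring.
Qed.

Lemma regular_iter alg x i : regular x -> regular (iter i (T alg) x).
Proof.
move=> rx; elim: i => [|i IHi]; first exact: rx.
by rewrite iterS; exact: (regular_step alg IHi).1.
Qed.

Lemma discriminant_iter alg x i : regular x ->
  discriminant (iter i (T alg) x) = discriminant x.
Proof.
move=> rx; elim: i => [//|i <-]; rewrite iterS.
exact/discriminant_step/regular_iter.
Qed.

(** The invariant discriminant recovers [c] from [b], so a recurrence of [b] alone suffices. *)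
Lemma iter_eq_coef_b alg x i j : regular x ->
  coef_b (iter i (T alg) x) = coef_b (iter j (T alg) x) ->
  iter i (T alg) x = iter j (T alg) x.
Proof.
move=> rx eb; apply: (regular_inj (regular_iter _ i rx) (regular_iter _ j rx) eb).
have := discriminant_iter alg i rx; rewrite -(discriminant_iter alg j rx).
by rewrite /discriminant eb; lia.
Qed.

(* Under Algorithm A the digit d is the residue of b mod p, and 2d - b has the
   same residue, so that two steps map b to 2d - (2d - b) = b. *)
Lemma algA_period2 x : regular x ->
  coef_b (iter 2 (T AlgorithmA) x) = coef_b x.
Proof.
move=> rx; have [ry [d [dp db eb _]]] := regular_step AlgorithmA rx.
have [_ [d' [dp' db' eb' _]]] := regular_step AlgorithmA ry.
have sgn (z : Qp) : alg_sign AlgorithmA z = -1 by [].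
rewrite [iter _ _ _]/= eb' !sgn; move: db' db; rewrite eb !sgn.
move: (coef_b x) => b db' db.
suff -> : d' = d by ring.
apply: (dvdz_sub_small dp' dp).
have -> : d'%:Z - d%:Z = d'%:Z + -1 * (2 * d%:Z + -1 * b) + (d%:Z + -1 * b) by ring.
by rewrite rpredD.
Qed.

Lemma alg_sign_notA alg x : alg <> AlgorithmA ->
  [\/ 0 <= coef_b x /\ alg_sign alg x = -1, coef_b x < 0 /\ alg_sign alg x = 1 |
      coef_c x <= 0 /\ alg_sign alg x = 1].
Proof.
rewrite /alg_sign /chooses_T2; case: alg => // _.
  by case: lerP; [constructor 1|constructor 2].
by case: (lerP 0 (coef_b x)) => b; case: (ltrP 0 (coef_c x)) => c /=;
  [constructor 1|constructor 3|constructor 2|constructor 2].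
Qed.

(* Algorithm C replaces b >= 0 by 2d + b only when c <= 0, which forces b^2 to
   be at most the invariant discriminant. *)
Lemma coef_b_bounded alg x : alg <> AlgorithmA -> regular x ->
  exists B : nat, forall i, `|coef_b (iter i (T alg) x)| <= B%:Z.
Proof.
(* When the sign opposes that of [b], the new value is at most the larger of [|b|] and [2p] in size;
   in the remaining case [|b|] is at most the discriminant, and [2d] adds less than [2p]. *)
move=> nA rx; exists (`|coef_b x| + `|discriminant x| + 2 * p)%N.
elim=> [|i IHi]; first by rewrite [iter _ _ _]/=; lia.
rewrite iterS; have ry := regular_iter alg i rx.
have [_ [d [/andP[_ dp] _ -> _]]] := regular_step alg ry.
have := alg_sign_notA (iter i (T alg) x) nA.
have := discriminant_iter alg i rx; move: IHi.
move: (discriminant x) (coef_b x) => D b0; rewrite /discriminant.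
set y := iter i _ _; move: (coef_b y) (coef_c y) (alg_sign alg y) => b c e.
move=> IHi disc; case=> -[h ->]; [by lia|by lia|].
have : `|b| <= b ^+ 2 by nia.
by lia.
Qed.

Lemma regular_repeat alg x : regular x ->
  exists i j, (i < j)%N /\ iter i (T alg) x = iter j (T alg) x.
Proof.
move=> rx; case: (EM (alg = AlgorithmA)) => [->|nA].
  by exists 0%N, 2%N; split=> //; apply/esym/iter_eq_coef_b/algA_period2.
have [B /bounded_int_repeat[i [j [ij eb]]]] := coef_b_bounded nA rx.
by exists i, j; split; [exact: ij|exact: iter_eq_coef_b].
Qed.

(** * Reaching the regular regime *)

Definition conjugate_pair x x' :=
  exists a b c, a != 0 /\ quad_roots a b c x x'.

Lemma alg_T_conj alg x x' : irrational x -> in_pZp x -> conjugate_pair x x' ->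
  let y := alg_T alg x in
  [/\ irrational y, in_pZp y & exists2 y', conjugate_pair y y' &
     padic_val (y - y') = padic_val (x - x') - padic_val x'].
Proof.
move=> irr xp [a [b [c [a0 rts]]]] /=; rewrite alg_TE.
have [irry yp [a1 [b1 [c1 [y' [a10 rts1 v]]]]]] :=
  signed_T_conj (alg_sign_cases alg x) irr xp a0 rts.
by split; [exact: irry|exact: yp|exists y'; [exists a1, b1, c1|exact: v]].
Qed.

(** Induction on a bound for the valuation of [x - x']. If [x'] lies outside pZ_p, the next image is
    regular. Otherwise this valuation is positive, and the next step lowers it by that of [x'],
    which is positive as well. *)
Lemma reaches_regular alg x x' : irrational x -> in_pZp x ->
  conjugate_pair x x' -> exists n, regular (iter n (T alg) x).
Proof.
suff main (N : nat) : forall x x', irrational x -> in_pZp x ->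
    conjugate_pair x x' -> padic_val (x - x') <= N%:Z ->
    exists n, regular (iter n (T alg) x).
  move=> irr xp xx'; apply: (main `|padic_val (x - x')%R|%N x x' irr xp xx').
  exact: lez_abs.
have one (z z' : Qp) : irrational z -> in_pZp z -> conjugate_pair z z' ->
    regular (alg_T alg z) \/ 0 < padic_val z' /\ 0 < padic_val (z - z').
  move=> irr zp [a [b [c [a0 rts]]]].
  have [z'p|z'p] := EM (in_pZp z'); [right|left].
    have [zz' z'0] := quad_roots_neq irr a0 rts.
    have := in_pZpB zp z'p; move: z'p; rewrite !in_pZpP => v v'; split.
      by case: v => // /eqP; rewrite (negPf z'0).
    by case: v' => // /eqP; rewrite subr_eq0 eq_sym (negPf zz').
  have [mq sz q2 rts'] := minpolyP irr a0 rts.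
  have nb := conj_notin_pZp mq sz rts' zp z'p; rewrite alg_TE.
  have q20 : (minpoly z)`_2 != 0 by case: ltgtP q2.
  exact: (signed_T_regular (alg_sign_cases alg z) irr zp q20 rts' nb).1.
elim: N => [|N IHN] {}x {}x' irr xp xx' le.
  by case: (one _ _ irr xp xx') => [rx|[_ lt]]; [exists 1%N | move: le; lia].
case: (one _ _ irr xp xx') => [rx|[v v']]; first by exists 1%N.
have [irry yp [y' yy' vy]] := alg_T_conj alg irr xp xx'.
have [|n rn] := IHN _ _ irry yp yy'; first by rewrite vy; lia.
by exists n.+1; rewrite iterSr.
Qed.

Lemma iter_alg_T_conj alg x x' i : irrational x -> in_pZp x ->
  conjugate_pair x x' -> irrational (iter i (T alg) x).
Proof.
move=> irr xp xx'.
suff [] : [/\ irrational (iter i (T alg) x), in_pZp (iter i (T alg) x) &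
  exists y', conjugate_pair (iter i (T alg) x) y'] by [].
elim: i => [|i [irri xpi [y' yy']]]; first by split; [exact: irr|exact: xp|exists x'].
rewrite iterS; have [irry yp [z' zz' _]] := alg_T_conj alg irri xpi yy'.
by split; [exact: irry|exact: yp|exists z'].
Qed.

Lemma orbit_repeat alg x x' : irrational x -> in_pZp x -> conjugate_pair x x' ->
  exists i j, (i < j)%N /\ iter i (T alg) x = iter j (T alg) x.
Proof.
move=> irr xp xx'; have [n rn] := reaches_regular alg irr xp xx'.
have [i [j [ij e]]] := regular_repeat alg rn.
by exists (i + n)%N, (j + n)%N; rewrite ltn_add2r !iterD.
Qed.

End Regime.

(** * Digit expansions *)

Section Expansion.
Variables (p : nat) (p_pr : prime p).
Local Notation Qp := (padic p_pr).
Implicit Types x y : Qp.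

(** Replaces a finitely supported sum over an infinite index set by one over an explicit list
    carrying all nonzero digits. *)
Lemma digit_sum_seq (e : int -> nat) (A : set int) (r : seq int) : uniq r ->
  (forall i, i \in r -> A i) -> (forall i, A i -> i \notin r -> e i = 0%N) ->
  digit_sum p_pr e A = \sum_(i <- r) ((e i)%:R * p%:R ^ i : Qp).
Proof.
move=> ur rA Ar; rewrite /digit_sum (fsbigE r) //.
  by rewrite big_seq_cond [RHS]big_seq; apply: eq_bigl => i;
    case: (boolP (i \in r)) => // /rA Ai; rewrite mem_set.
by move=> i Ai ir; rewrite (Ar i Ai ir) mul0r.
Qed.

(** Whatever the digits are, the head is a finite sum of integers times powers of [p]; subtracting
    it then preserves irrationality and degree. *)
Lemma padic_head_rational x : exists q m : int,
  q != 0 /\ q%:~R * padic_head x = m%:~R.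
Proof.
rewrite /padic_head /digit_sum.
elim/big_ind: _ => [|y z [q [m [q0 ey]]] [q' [m' [q'0 ez]]]|i _].
- by exists 1, 0; rewrite mulr0.
- exists (q * q'), (q' * m + q * m'); split; first by rewrite mulf_neq0.
  by rewrite !(rmorphD, rmorphM) /= -ey -ez; ring.
- case: i => n.
    exists 1, ((padic_digit x n)%:Z * (p ^ n)%N); split => //.
    rewrite mul1r rmorphM /= -pmulrn -exprnP; congr (_ * _).
    by rewrite -[RHS]pmulrn natrX.
  exists (p ^ n.+1)%N, (padic_digit x (Negz n))%:Z; split.
    by have := expp_gt0 p_pr n.+1; lia.
  rewrite NegzE -exprnN -[((p ^ _)%N)%:~R]pmulrn natrX mulrCA divff ?mulr1 //.
  exact: expf_neq0 (padic_p_neq0 p_pr).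
Qed.

Lemma in_pZp_abs x : padic_abs x < 1 -> in_pZp x.
Proof.
rewrite in_pZpP /padic_abs; have [->|x0] := eqVneq x 0; first by left.
move=> h; right; rewrite ltNge; apply: contraL h; rewrite -leNgt.
move=> v0; have [n ->] : exists n : nat, - padic_val x = n.
  by exists `|padic_val x|%N; lia.
by rewrite -exprnP -natrX ler1n expp_gt0.
Qed.

(** The crude bound [v < p^v] lets any [n] above [1 / eps] serve. *)
Lemma padic_abs_lt (n : nat) x (eps : rat) : x = 0 \/ n%:Z <= padic_val x ->
  0 < eps -> eps^-1 < n%:R -> padic_abs x < eps.
Proof.
rewrite /padic_abs; have [//|x0] := eqVneq x 0.
case=> [/eqP|]; first by rewrite (negPf x0).
case: (padic_val x) => // v le_nv eps0 lt; rewrite -exprnN.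
rewrite -[eps]invrK ltf_pV2 ?posrE ?invr_gt0 // -?natrX ?ltr0n ?expp_gt0 //.
apply: (lt_le_trans lt); rewrite ler_nat; apply: (leq_trans le_nv).
exact/ltnW/ltn_expl/prime_gt1.
Qed.

Lemma padic_val_res (z : padic_int p_pr) (J : nat) : z J = 0 ->
  padic_of_int z = 0 \/ J%:Z <= padic_val (padic_of_int z).
Proof.
move=> zJ; have [->|z0] := eqVneq z 0; [by left; rewrite rmorph0|right].
have [n [w [wU e]]] := padic_int_factor z0.
rewrite e rmorphM rmorphXn rmorph_nat exprnP padic_valE //= lez_nat leqNgt.
apply/negP => lt_nJ.
have : ((p ^ n.+1)%N %| z n.+1)%Z.
  by rewrite (padic_resP z lt_nJ) zJ mod0z dvdz0.
rewrite e -natrX [_%:R]pmulrn /= padic_res_intr modzMml => /dvdz_mod0P.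
rewrite modz_mod => /dvdz_mod0P; rewrite expnSr PoszM dvdz_mul2l.
  have := padic_dvd_res w (isT : (1 <= n.+1)%N); rewrite expn1 => ->; apply/negP.
  by rewrite -padic_int_unitE.
by have := expp_gt0 p_pr n; lia.
Qed.

Lemma padic_expansion_ex x : exists e, is_padic_expansion e x.
Proof.
have [m [a xE]] : exists (m : nat) (a : padic_int p_pr),
    x = p%:R ^- m * padic_of_int a.
  have [->|/padic_factor[k [w [_ ->]]]] := eqVneq x 0.
    by exists 0%N, 0; rewrite rmorph0 mulr0.
  case: k => k; first by exists 0%N, (p%:R ^+ k * w);
    rewrite expr0 invr1 mul1r rmorphM rmorphXn rmorph_nat.
  by exists k.+1, w; rewrite NegzE -exprnN.
have a_ge0 n : 0 <= a n.
  by rewrite -padic_res_id modz_ge0 //; have := expp_gt0 p_pr n; lia.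
have a_lt n : a n < (p ^ n)%N.
  by rewrite -[a n]padic_res_id ltz_pmod //; have := expp_gt0 p_pr n; lia.
(* Consecutive residues differ by a multiple of [p ^ n]; the quotient is the base-p digit of index
   [n] of [a]. The digits of [x] are these, shifted by [m]. *)
pose dg n := (a n.+1 %/ (p ^ n)%N)%Z.
have dgE n : a n.+1 = dg n * (p ^ n)%N + a n.
  by rewrite [LHS](divz_eq _ (p ^ n)%N) -(padic_resP a (leqnSn n)).
have dg_ge0 n : 0 <= dg n.
  by rewrite divz_ge0 //; have := expp_gt0 p_pr n; lia.
have dg_lt n : dg n < p.
  rewrite ltz_divLR; last by have := expp_gt0 p_pr n; lia.
  by rewrite -PoszM -expnS.
pose e (i : int) := if 0 <= i + m%:Z then `|dg `|(i + m%:Z)%R|%N|%N else 0%N.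
have eE (j : nat) : (e (j%:Z - m%:Z))%:R = (dg j)%:~R :> Qp.
  by rewrite /e subrK /= pmulrn gez0_abs.
have sumE J : \sum_(0 <= j < J) ((e (j%:Z - m%:Z))%:R * p%:R ^ (j%:Z - m%:Z) : Qp) =
    p%:R ^- m * (a J)%:~R.
  elim: J => [|J IHJ].
    rewrite big_nil; have -> : a 0%N = 0 by have := a_ge0 0%N; have := a_lt 0%N; lia.
    by rewrite mulr0.
  rewrite big_nat_recr //= IHJ eE dgE rmorphD rmorphM /=.
  rewrite expfzDr ?padic_p_neq0 // -exprnN -exprnP -[((p ^ J)%N)%:~R]pmulrn natrX.
  by ring.
exists e; split.
- move=> i; rewrite /e; case: ifP => _; last exact: prime_gt0.
  by have := dg_lt `|(i + m%:Z)%R|%N; have := dg_ge0 `|(i + m%:Z)%R|%N; lia.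
- pose r := [seq j%:Z - m%:Z | j <- iota 0 m.+1].
  apply: (@sub_finite_set _ _ [set` r]%classic); last exact: finite_seq.
    move=> i /= /andP[i0]; rewrite /e; case: ifP => // im _.
    by apply/mapP; exists `|(i + m%:Z)%R|%N; rewrite ?mem_iota; lia.
- move=> eps eps0; exists (Num.bound eps^-1) => n le_n.
  (* Indices from [-m] to [n], hence [n + m + 1] terms. *)
  pose r := [seq j%:Z - m%:Z | j <- iota 0 (n + m).+1].
  have -> : digit_sum p_pr e [set i | i <= n%:Z]%classic = p%:R ^- m * (a (n + m).+1)%:~R.
    rewrite (@digit_sum_seq _ _ r).
    - by rewrite big_map -sumE /index_iota subn0.
    - by rewrite map_inj_uniq ?iota_uniq // => i j; lia.
    - by move=> i /mapP[j]; rewrite mem_iota => jn -> /=; lia.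
    - move=> i /= ile; rewrite /e; case: ifP => // im /mapP[].
      by exists `|(i + m%:Z)%R|%N; rewrite ?mem_iota; lia.
  rewrite xE -mulrBr.
  pose z : padic_int p_pr := a - (a (n + m).+1)%:~R.
  have zE : padic_of_int a - (a (n + m).+1)%:~R = padic_of_int z.
    by rewrite rmorphB rmorph_int.
  have zJ : z (n + m).+1 = 0.
    by rewrite /z /= padic_res_intr padic_res_id modzDmr subrr mod0z.
  rewrite zE; apply: (@padic_abs_lt n) => //; last first.
    by apply: (lt_le_trans (archi_boundP _)); rewrite ?invr_ge0 ?ler_nat // ltW.
  have [->|z0] := eqVneq (padic_of_int z) 0; first by left; rewrite mulr0.
  right; have pm := expfz_neq0 (- m%:Z) (padic_p_neq0 p_pr).
  rewrite exprnN (padic_valM pm z0) padic_val_expp.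
  by case: (padic_val_res zJ) => [/eqP|]; rewrite ?(negPf z0) //; lia.
Qed.

Lemma in_pZp_tail x : in_pZp (padic_tail x).
Proof.
have : is_padic_expansion (padic_digit x) x.
  exact: (@xgetPex _ _ [set e | is_padic_expansion e x]%classic (padic_expansion_ex x)).
rewrite /padic_tail /padic_head; move: (padic_digit x) => e [elt fin lim].
have [X XE] := finite_fsetP.1 fin.
(* Precision 1 is enough: the error of this partial sum lies in pZ_p, and so do its terms of index 1
   to [N], which [r1] lists. *)
have [N /(_ N (leqnn N)) lt1] := lim 1 ltr01.
pose r1 := [seq (k.+1)%:Z | k <- iota 0 N].
have memX i : (i \in X) = (i <= 0) && (e i != 0%N).
  apply/idP/idP => h; last by have : [set` X]%classic i by rewrite -XE.
  by have : [set` X]%classic i by []; rewrite -XE.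
have headE : digit_sum p_pr e [set i | i <= 0]%classic =
    \sum_(i <- X) ((e i)%:R * p%:R ^ i : Qp).
  apply: digit_sum_seq; first exact: fset_uniq.
    by move=> i; rewrite memX => /andP[].
  by move=> i /= i0; rewrite memX i0 /= negbK => /eqP.
have sumE : digit_sum p_pr e [set i | i <= N%:Z]%classic =
    \sum_(i <- X) ((e i)%:R * p%:R ^ i : Qp) + \sum_(i <- r1) ((e i)%:R * p%:R ^ i : Qp).
  rewrite -big_cat; apply: digit_sum_seq.
  - rewrite cat_uniq fset_uniq map_inj_uniq ?iota_uniq ?andbT; last by move=> i j; lia.
    by apply/hasPn => i /mapP[j _ ->]; rewrite memX; lia.
  - move=> i; rewrite mem_cat memX => /orP[/andP[] /= | /mapP[j]]; first by lia.
    by rewrite mem_iota => jN -> /=; lia.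
  - move=> i /= iN; rewrite mem_cat memX negb_or => /andP[].
    have [i0 /=|i0 _] := lerP i 0; first by rewrite negbK => /eqP.
    by case/mapP; exists `|i|.-1%N; rewrite ?mem_iota; lia.
rewrite headE; set h := \sum_(i <- X) _ in sumE *.
have -> : x - h = (x - digit_sum p_pr e [set i | i <= N%:Z]%classic) +
    \sum_(i <- r1) ((e i)%:R * p%:R ^ i : Qp) by rewrite sumE; ring.
apply: in_pZpD; first exact: in_pZp_abs.
rewrite big_map; elim/big_ind: _ => [|u v|k _].
- by apply/in_pZpP; left.
- exact: in_pZpD.
- exists ((e k.+1)%:R * p%:R ^+ k).
  by rewrite rmorphM rmorphXn !rmorph_nat -exprnP exprS; ring.
Qed.

End Expansion.

(** * Passing to the tail, and periodicity *)

Lemma vieta_shift (F : fieldType) (a b c x x' P m h : F) : P * h = m ->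
  a * (x + x') = - b -> a * (x * x') = c ->
  P ^+ 2 * a * ((x - h) + (x' - h)) = - (P ^+ 2 * b + 2 * P * a * m) /\
  P ^+ 2 * a * ((x - h) * (x' - h)) = P ^+ 2 * c + P * m * b + a * m ^+ 2.
Proof.
move=> <- eb <-; have -> : b = - (a * (x + x')) by rewrite eb opprK.
by split; ring.
Qed.

Section Main.
Variables (p : nat) (p_pr : prime p).

Lemma quadratic_tail (x : padic p_pr) : quadratic x ->
  irrational (padic_tail x) /\ exists y, conjugate_pair (padic_tail x) y.
Proof.
move=> /quadraticP[irr [a [b [c [x' [a0 [s m]]]]]]].
have [q [h [q0 hE]]] := padic_head_rational x.
rewrite /padic_tail; split.
  move=> u v e; have e' : (q * u)%:~R * x + (q * v - u * h)%:~R = 0.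
    rewrite rmorphB !rmorphM /= -hE.
    have -> : 0 = q%:~R * 0 :> padic p_pr by rewrite mulr0.
    by rewrite -e; ring.
  by have /eqP := irr _ _ e'; rewrite mulf_eq0 (negPf q0) => /eqP.
have [s1 m1] := vieta_shift hE s m.
(* The factor [q ^+ 2] clears the denominator of the shift by [h / q]. *)
exists (x' - padic_head x), (q ^+ 2 * a), (q ^+ 2 * b + 2 * q * a * h),
  (q ^+ 2 * c + q * h * b + a * h ^+ 2).
split; first by rewrite mulf_neq0 ?expf_neq0.
by split; rewrite !(rmorphD, rmorphM, rmorphXn) /=; [rewrite s1|rewrite m1].
Qed.

End Main.

Theorem theorem7p1 (p : nat) (p_pr : prime p) (alpha : padic p_pr) :
  quadratic alpha ->
  forall alg : algorithm, eventually_periodic (expansion alg alpha).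
Proof.
move=> /quadratic_tail[irr [y xy]] alg; have tp := in_pZp_tail alpha.
pose orbit i := iter i (alg_T alg (p_pr := p_pr)) (padic_tail alpha).
(* Every iterate is irrational, hence nonzero, so the fraction never terminates. *)
have nz i : [exists j : 'I_i, orbit j == 0] = false.
  apply/existsP => -[j]; apply/negP.
  exact: irrational_neq0 (@iter_alg_T_conj _ _ alg _ _ j irr tp xy).
have termE i : cf_term (expansion alg alpha) i =
    Some (alg_t alg (orbit i.-1), padic_val (orbit i.-1), alg_d alg (orbit i.-1)).
  by rewrite /expansion /= nz.
split=> [i _|]; first by rewrite termE.
have [i [j [ij e]]] := orbit_repeat alg irr tp xy.
(* The term of index [n] reads the orbit at [n.-1], so an orbit periodic from [i] on gives terms
   periodic from [i.+1] on. *)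
exists (j - i)%N, i.+1; split=> [|//|n ni]; first by rewrite subn_gt0.
suff orbE : orbit (n + (j - i)).-1 = orbit n.-1 by rewrite !termE orbE.
rewrite /orbit; have -> : (n + (j - i)).-1 = (n.-1 - i + j)%N by lia.
by rewrite iterD -e -iterD subnK //; lia.
Qed.
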